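(* Let $w$ be a positive graph function that is $\lambda$-multiplicative for some fixed $\lambda>0$. Let $G=(V,E)$ be a finite simple graph with $|V|=n$, and let $\mathrm{tw}(G)$ denote the tree-width of $G$. Then the mixing time of the single bond flip chain $\mathcal{M}$ on $G$ with weight function $w$ satisfies $$\tau(\varepsilon)=O\left(n^{4+4(\mathrm{tw}(G)+1)|\log_2\lambda|}\,\log(1/\varepsilon)\right).$$
   Context: All graphs are finite and simple. A graph function $w$ assigns a real number to every graph, isomorphic graphs receiving the same number; here $w$ is assumed positive: $w(G)>0$ for every graph $G$. Write $\hat\lambda:=\max\{\lambda,1/\lambda\}$. Vertex cuts. For $G=(V,E)$, a vertex cut $K\subseteq V$ separates sets $V_1$ and $V_2$ if $(V_1,K,V_2)$ is a partition of $V$ (parts may be empty) and no edge of $E$ joins a vertex of $V_1$ to a vertex of $V_2$. A partition $(E_1,E_2)$ of $E$ (parts may be empty) is appropriate for $K$ if no edge of $E_1$ is incident to a vertex of $V_2$ and no edge of $E_2$ is incident to a vertex of $V_1$. $\lambda$-multiplicativity. For fixed $\lambda>0$, $w$ is $\lambda$-multiplicative if for every graph $G=(V,E)$, every vertex cut $K$ separating sets $V_1$ and $V_2$, and every partition $(E_1,E_2)$ of $E$ appropriate for $K$, $$\hat\lambda^{-|K|}\le\frac{w((V_1\cup K,E_1))\,w((V_2\cup K,E_2))}{w(G)}\le\hat\lambda^{|K|}.$$ Single bond flip chain $\mathcal{M}$ on $G=(V,E)$ (with $E\neq\emptyset$): the state space is $\Omega=2^E$. From $X_t\subseteq E$, pick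 $e\in E$ uniformly at random, let $S=X_t\oplus\{e\}$ ($\oplus$ is symmetric difference), and set $X_{t+1}=S$ with probability $\frac12\min\{1,w((V,S))/w((V,X_t))\}$ and $X_{t+1}=X_t$ otherwise. Its unique stationary distribution $\pi$ satisfies $\pi(S)\propto w((V,S))$. Mixing time. $\|\nu-\nu'\|_{TV}=\frac12\sum_{H\in\Omega}|\nu(H)-\nu'(H)|$, and with $P$ the transition matrix, $\tau(\varepsilon)=\max_{H\in\Omega}\min\{t: \|P^t(H,\cdot)-\pi\|_{TV}\le\varepsilon\}$. In the bound, $0<\varepsilon\le 1/2$, and the implied constant may depend on $w$, $\lambda$ and $\mathrm{tw}(G)$, but not otherwise on $G$ and not on $\varepsilon$. *)

(* Defs.v *)
From mathcomp Require Import all_boot all_order all_algebra.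
From mathcomp Require Import all_classical all_reals all_analysis.
Set Implicit Arguments.
Unset Strict Implicit.
Unset Printing Implicit Defensive.
Import Order.TTheory GRing.Theory Num.Theory.
Local Open Scope ring_scope.

(* Finite simple graphs: an edge is a set of two vertices. *)
Record sgraph := SGraph {
  vertex :> finType;
  edges : {set {set vertex}};
  edgesP : [forall e in edges, #|e| == 2%N]
}.

Definition adj (G : sgraph) : rel G := fun x y => [set x; y] \in edges G.

Definition isomorphic (G H : sgraph) : Prop :=
  exists2 f : G -> H, bijective f & forall x y, adj (f x) (f y) = adj x y.

(* The edge set as a type, so that 2^E is the finite type {set edge G}. *)
Definition edge (G : sgraph) : finType := {e : {set G} | e \in edges G}.

Lemma spanning_subproof (G : sgraph) (S : {set edge G}) :
  [forall e in [set val f | f in S], #|e| == 2%N].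
Proof.
apply/forall_inP => _ /imsetP[f _ ->].
by move/forall_inP: (edgesP G); apply; apply: valP.
Qed.

(* The graph (V, S). *)
Definition spanning (G : sgraph) (S : {set edge G}) : sgraph :=
  SGraph (spanning_subproof S).

Lemma subgraph_subproof (G : sgraph) (U : {set G}) (F : {set edge G}) :
  [forall e in [set e : {set {x : G | x \in U}} |
                  val @: e \in edges (spanning F)], #|e| == 2%N].
Proof.
apply/forall_inP => e; rewrite inE => eF.
rewrite -(card_imset (mem e) val_inj).
by move/forall_inP: (edgesP (spanning F)); apply.
Qed.

(* The graph (U, F); it is used only when every edge of F lies inside U. *)
Definition subgraph (G : sgraph) (U : {set G}) (F : {set edge G}) : sgraph :=
  SGraph (subgraph_subproof U F).

Section TreeWidth.

Definition is_tree (T : sgraph) : Prop :=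
  [/\ (0 < #|T|)%N,
      forall x y : T, connect (@adj T) x y
    & forall p : seq T, ucycle (@adj T) p -> (size p < 3)%N].

Definition tree_decomposition (G T : sgraph) (B : T -> {set G}) : Prop :=
  [/\ is_tree T,
      forall v : G, exists t, v \in B t,
      forall e, e \in edges G -> exists t, e \subset B t
    & forall (v : G) (s t : T), v \in B s -> v \in B t ->
        connect [rel a b | [&& adj a b, v \in B a & v \in B b]] s t].

(* Truncated at 0 for the graph without vertices. *)
Definition width (G T : sgraph) (B : T -> {set G}) : nat :=
  (\max_(t : T) #|B t|)%N.-1.

Definition has_tree_decomposition (G : sgraph) (k : nat) : Prop :=
  exists (T : sgraph) (B : T -> {set G}),
    tree_decomposition B /\ width B = k.

Lemma point_subproof : [forall e in (finset.set0 : {set {set unit}}), #|e| == 2%N].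
Proof. by apply/forall_inP => e; rewrite inE. Qed.

Lemma tree_decomposition_exists (G : sgraph) :
  exists k, `[< has_tree_decomposition G k >].
Proof.
exists (#|G|).-1; apply/asboolP.
exists (SGraph point_subproof), (fun=> [set: G]); split; last first.
  by rewrite /width big_const card_unit /= maxn0 cardsT.
have conn (r : rel unit) x y : connect r x y by case: x y => -[].
split=> [|v|e _|v s t _ _].
- split=> //=; first by rewrite card_unit.
  by case=> [|x [|y [|z p]]] //= /andP[/andP[]]; rewrite /adj /= inE.
- by exists tt; rewrite inE.
- by exists tt; apply: finset.subsetT.
- exact: conn.
Qed.

Definition treewidth (G : sgraph) : nat := ex_minn (tree_decomposition_exists G).

End TreeWidth.

Section GraphFunctions.
Variable R : realType.
Implicit Types (w : sgraph -> R) (lambda : R) (G : sgraph).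

Definition graph_function w : Prop :=
  forall G H, isomorphic G H -> w G = w H.

Definition separates G (K V1 V2 : {set G}) : Prop :=
  [/\ V1 :|: K :|: V2 = [set: G],
      [/\ [disjoint V1 & K], [disjoint V1 & V2] & [disjoint K & V2]]
    & forall x y, x \in V1 -> y \in V2 -> ~~ adj x y].

Definition appropriate G (V1 V2 : {set G}) (E1 E2 : {set edge G}) : Prop :=
  [/\ E1 :|: E2 = [set: edge G], [disjoint E1 & E2],
      forall e, e \in E1 -> [disjoint val e & V2]
    & forall e, e \in E2 -> [disjoint val e & V1]].

Definition lhat lambda : R := Num.max lambda lambda^-1.

Definition lambda_multiplicative lambda w : Prop :=
  forall G (K V1 V2 : {set G}) (E1 E2 : {set edge G}),
    separates K V1 V2 -> appropriate V1 V2 E1 E2 ->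
    lhat lambda ^- #|K|
      <= w (subgraph (V1 :|: K) E1) * w (subgraph (V2 :|: K) E2) / w G
      <= lhat lambda ^+ #|K|.

End GraphFunctions.

Section FiniteChains.
Variables (R : realType) (T : finType).
Implicit Types (P : T -> T -> R) (nu pi : T -> R).

Definition transition_mx P : 'M[R]_#|T| :=
  \matrix_(i, j) P (enum_val i) (enum_val j).

(* P^t(x, y) *)
Definition step P (t : nat) (x y : T) : R :=
  (transition_mx P ^+ t) (enum_rank x) (enum_rank y).

Definition tv_dist nu nu' : R := 2^-1 * \sum_x `|nu x - nu' x|.

(* Extended-real valued: the minimum over an empty set of times is +oo. *)
Definition mixing_time P pi (eps : R) : \bar R :=
  \big[maxe/-oo%E]_(x : T)
    ereal_inf
      [set (t%:R)%:E | t in [set t : nat | tv_dist (step P t x) pi <= eps]]%classic.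

Definition is_distr nu : Prop := (forall x, 0 <= nu x) /\ \sum_x nu x = 1.

Definition stationary P nu : Prop := forall y, \sum_x nu x * P x y = nu y.

End FiniteChains.

Section SingleBondFlip.
Variables (R : realType) (w : sgraph -> R) (G : sgraph).
Implicit Types (S H : {set edge G}) (e : edge G).

Definition flip S e : {set edge G} := (S :\: [set e]) :|: ([set e] :\: S).

Definition accept H S : R :=
  2^-1 * Num.min 1 (w (spanning S) / w (spanning H)).

Definition bond_flip H S : R :=
  \sum_e #|edge G|%:R^-1 *
    (accept H (flip H e) * (flip H e == S)%:R
     + (1 - accept H (flip H e)) * (H == S)%:R).

Definition gibbs S : R :=
  w (spanning S) / \sum_(H : {set edge G}) w (spanning H).

Hypothesis w_pos : forall G', 0 < w G'.

Lemma flipE S e x : (x \in flip S e) = (x == e) (+) (x \in S).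
Proof. by rewrite !inE; case: eqP => [->|_]; case: (_ \in S). Qed.

Lemma flipK e : involutive (flip^~ e).
Proof. by move=> S; apply/setP => x; rewrite !flipE addbA addbb. Qed.

Lemma flip_neq S e : flip S e != S.
Proof.
by apply/eqP => /setP/(_ e); rewrite flipE eqxx; case: (_ \in S).
Qed.

Lemma Z_gt0 : 0 < \sum_(H : {set edge G}) w (spanning H).
Proof.
rewrite (bigD1 finset.set0) //= ltr_pwDl //.
by apply: sumr_ge0 => H _; apply: ltW.
Qed.

Lemma gibbs_gt0 S : 0 < gibbs S.
Proof. by rewrite divr_gt0 ?Z_gt0. Qed.

Lemma gibbs_distr : is_distr gibbs.
Proof.
split=> [S|]; first by apply/ltW/gibbs_gt0.
by rewrite -mulr_suml divff // gt_eqF ?Z_gt0.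
Qed.

Lemma accept_gt0 H S : 0 < accept H S.
Proof. by rewrite mulr_gt0 ?invr_gt0 // lt_min ltr01 divr_gt0. Qed.

Lemma accept_le1 H S : accept H S <= 1.
Proof.
rewrite -[leRHS](@mulVf _ 2) // ler_pM2l ?invr_gt0 //.
by rewrite ge_min ler1n.
Qed.

Lemma gibbs_accept H S : gibbs H * accept H S = gibbs S * accept S H.
Proof.
rewrite /gibbs /accept !(mulrAC _ _^-1) !(mulrCA _ 2^-1); congr (_ * _ * _).
by rewrite !minr_pMr ?ltW // !mulr1 ![_ * (_ / _)]mulrC !divfK ?gt_eqF // minC.
Qed.

Lemma gibbs_reversible H S :
  gibbs H * bond_flip H S = gibbs S * bond_flip S H.
Proof.
have [->//|HS] := eqVneq H S.
rewrite /bond_flip !mulr_sumr; apply: eq_bigr => e _.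
rewrite [S == H]eq_sym (negPf HS) !mulr0 !addr0.
rewrite (mulrCA (gibbs H)) (mulrCA (gibbs S)).
congr (_ * _); have [<-|HeS] := eqVneq (flip H e) S.
  by rewrite flipK eqxx !mulr1 gibbs_accept.
rewrite (_ : (flip S e == H) = false) ?mulr0 //.
by apply/negbTE/eqP => SeH; rewrite -SeH flipK eqxx in HeS.
Qed.

Hypothesis E_neq0 : edges G != finset.set0.

Lemma edge_gt0 : (0 < #|edge G|)%N.
Proof. by case/set0Pn: E_neq0 => e eE; apply/card_gt0P; exists (exist _ e eE). Qed.

Lemma sum_delta H : \sum_S (H == S)%:R = 1 :> R.
Proof.
rewrite (bigD1 H) //= eqxx big1 ?addr0 // => S.
by rewrite eq_sym => /negbTE->.
Qed.

Lemma bond_flip_sum H : \sum_S bond_flip H S = 1.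
Proof.
rewrite exchange_big /=.
under eq_bigr => e _ do
  rewrite -mulr_sumr big_split /= -!mulr_sumr !sum_delta !mulr1 addrC subrK mulr1.
by rewrite sumr_const -[X in X *+ _]mul1r -mulrnAr -mulr_natr mulVf ?mul1r // pnatr_eq0 -lt0n edge_gt0.
Qed.

Lemma bond_flip_ge0 H S : 0 <= bond_flip H S.
Proof.
apply: sumr_ge0 => e _; rewrite mulr_ge0 ?invr_ge0 ?ler0n // addr_ge0 //.
  by rewrite mulr_ge0 // ltW ?accept_gt0.
by rewrite mulr_ge0 // subr_ge0 accept_le1.
Qed.

Lemma bond_flip_gt0 H e : 0 < bond_flip H (flip H e).
Proof.
rewrite /bond_flip (bigD1 e) //= ltr_pwDl //.
  rewrite eqxx eq_sym (negPf (flip_neq H e)) mulr1 mulr0 addr0.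
  by rewrite mulr_gt0 ?accept_gt0 // invr_gt0 ltr0n edge_gt0.
apply: sumr_ge0 => f _; rewrite mulr_ge0 ?invr_ge0 ?ler0n // addr_ge0 //.
  by rewrite mulr_ge0 // ltW ?accept_gt0.
by rewrite mulr_ge0 // subr_ge0 accept_le1.
Qed.

Lemma gibbs_stationary : stationary bond_flip gibbs.
Proof.
move=> S; under eq_bigr => H _ do rewrite gibbs_reversible.
by rewrite -mulr_sumr bond_flip_sum mulr1.
Qed.

Lemma stationary_gibbs (nu : {set edge G} -> R) :
  is_distr nu -> stationary bond_flip nu -> nu =1 gibbs.
Proof.
move=> [_ nu1] nuP.
have [f fE] : exists f, forall S, nu S = gibbs S * f S.
  by exists (fun S => nu S / gibbs S) => S; rewrite mulrC divfK ?gt_eqF ?gibbs_gt0.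
have fP S : \sum_H bond_flip S H * (f S - f H) = 0.
  under eq_bigr => H _ do rewrite mulrBr.
  rewrite sumrB -mulr_suml bond_flip_sum mul1r; apply/eqP; rewrite subr_eq0.
  rewrite -(inj_eq (mulfI (lt0r_neq0 (gibbs_gt0 S)))) -fE -{1}nuP mulr_sumr.
  by apply/eqP/eq_bigr => H _; rewrite fE mulrAC gibbs_reversible mulrA.
pose M := [arg max_(S > (finset.set0 : {set edge G})) f S]%O.
have fM S : f S <= f M by rewrite /M; case: arg_maxP => // m _; apply.
have fflip S e : f S = f M -> f (flip S e) = f M.
  move=> fS; apply/eqP; rewrite eq_sym -subr_eq0 -fS.
  have ge0 H : true -> 0 <= bond_flip S H * (f S - f H).
    by rewrite mulr_ge0 ?bond_flip_ge0 // subr_ge0 fS.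
  have /(_ (flip S e) isT)/eqP := psumr_eq0P ge0 (fP S).
  by rewrite mulf_eq0 gt_eqF ?bond_flip_gt0.
have fcst n S H : #|[set x | (x \in S) (+) (x \in H)]| = n ->
    f S = f M -> f H = f M.
  elim: n S => [|n IH] S.
    move/cards0_eq/setP => SH; suff -> : S = H by [].
    by apply/setP => x; have := SH x; rewrite !inE; case: (_ \in S); case: (_ \in H).
  move=> SHn; have [e eSH] : exists e, e \in [set x | (x \in S) (+) (x \in H)].
    by apply/card_gt0P; rewrite SHn.
  move/(fflip S e); apply: IH; apply/eqP.
  rewrite -eqSS -SHn (cardsD1 e [set x | (x \in S) (+) _]) eSH eqSS; apply/eqP/eq_card => x.
  rewrite in_setD1 !finset.in_set !finset.in_set1; rewrite finset.in_set in eSH.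
  case: eqVneq => [->|_]; last by case: (x \in S).
  by move: eSH; case: (e \in S); case: (e \in H).
have fC H : f H = f M by apply: fcst (erefl _) (erefl (f M)).
move=> S; rewrite fE fC -[RHS]mulr1; congr (_ * _).
rewrite -nu1; under eq_bigr => H _ do rewrite fE fC.
by rewrite -mulr_suml (proj2 gibbs_distr) mul1r.
Qed.

End SingleBondFlip.

(* Main.v *)
Require Import Defs.
From mathcomp Require Import all_boot all_order all_algebra.
From mathcomp Require Import all_classical all_reals all_analysis.
From mathcomp Require Import ring lra zify.
Import Order.TTheory GRing.Theory Num.Theory.
Import mathcomp.boot.fintype mathcomp.boot.finset.
Local Open Scope ring_scope.
Set Implicit Arguments.
Unset Strict Implicit.
Unset Printing Implicit Defensive.

(* The canonical path from I to F treats the edges one at a time, in a fixed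
   order e_1, ..., e_m, giving each edge its status in F. With A the set of
   treated edges, the current state S agrees with F on A and with I outside A;
   the complementary state U agrees with I on A and with F outside A, and
   (I, F) |-> (S, U) is a bijection. The vertices incident both to A and to its
   complement form a vertex cut of size b, so multiplicativity applied to
   I, F, S and U gives pi(I) pi(F) <= lhat^(4b) pi(S) pi(U). This bounds the
   congestion of the paths, hence yields a Poincare inequality with constant
   4 m^2 lhat^(4b). Since the chain is lazy and reversible, its L2 distance to
   pi contracts at the corresponding rate.

   A good order comes from recursively splitting a vertex set U by a bag that
   leaves at most half of U on each branch of the decomposition tree: each of
   the at most 1 + log_2 n levels of the recursion adds tw + 1 vertices to the
   cut, so b <= (tw + 1)(1 + log_2 n). The same recursion shows m <= b n, and
   log^3 n = O(n) gives m^3 = O(n^4). *)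

(** * Spectral gap and mixing of lazy reversible chains *)

(** The difference of the two sides is the variance of [f] under [p]. *)
Lemma sqr_sum_le (R : realType) (T : finType) (p f : T -> R) :
  (forall x, 0 <= p x) -> \sum_x p x = 1 ->
  (\sum_x p x * f x) ^+ 2 <= \sum_x p x * f x ^+ 2.
Proof.
move=> p_ge0 p1; have [a aE] : exists a, a = \sum_x p x * f x by eexists.
rewrite -aE.
have : 0 <= \sum_x p x * (f x - a) ^+ 2.
  by apply: sumr_ge0 => x _; rewrite mulr_ge0 ?sqr_ge0.
have -> : \sum_x p x * (f x - a) ^+ 2
    = \sum_x p x * f x ^+ 2 - 2 * a * (\sum_x p x * f x) + a ^+ 2 * \sum_x p x.
  rewrite !mulr_sumr -sumrB -big_split; apply: eq_bigr => x _ /=; ring.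
rewrite p1 -aE; lra.
Qed.

Section LazyReversibleChain.
Variables (R : realType) (T : finType) (P : T -> T -> R) (pi : T -> R).
Hypothesis pi_gt0 : forall x, 0 < pi x.
Hypothesis pi_sum : \sum_x pi x = 1.
Hypothesis P_ge0 : forall x y, 0 <= P x y.
Hypothesis P_sum : forall x, \sum_y P x y = 1.
Hypothesis P_rev : forall x y, pi x * P x y = pi y * P y x.
Hypothesis P_lazy : forall x, 2^-1 <= P x x.
Implicit Types f : T -> R.

(** Twice the variance of [f] under [pi]; [dirichlet] is likewise twice the usual Dirichlet form, so
    the Poincare constant is the usual one. *)
Definition pair_variance f := \sum_x \sum_y pi x * pi y * (f x - f y) ^+ 2.

Definition dirichlet f := \sum_x \sum_y pi x * P x y * (f x - f y) ^+ 2.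

Definition kernel_op f x := \sum_y P x y * f y.

Let P_stat y : \sum_x pi x * P x y = pi y.
Proof.
by under eq_bigr => x _ do rewrite P_rev; rewrite -mulr_sumr P_sum mulr1.
Qed.

Lemma pair_varianceE f :
  pair_variance f = 2 * \sum_x pi x * f x ^+ 2 - 2 * (\sum_x pi x * f x) ^+ 2.
Proof.
rewrite /pair_variance.
under eq_bigr => x _.
  have -> : \sum_y pi x * pi y * (f x - f y) ^+ 2
      = pi x * f x ^+ 2 * (\sum_y pi y)
        - 2 * (pi x * f x) * (\sum_y pi y * f y)
        + pi x * (\sum_y pi y * f y ^+ 2).
    rewrite !mulr_sumr -sumrB -big_split; apply: eq_bigr => y _ /=; ring.
  over.
rewrite big_split sumrB /= -!mulr_suml -mulr_sumr pi_sum; ring.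
Qed.

Lemma dirichletE f :
  dirichlet f
  = 2 * \sum_x pi x * f x ^+ 2 - 2 * \sum_x pi x * (f x * kernel_op f x).
Proof.
rewrite /dirichlet.
under eq_bigr => x _.
  have -> : \sum_y pi x * P x y * (f x - f y) ^+ 2
      = pi x * f x ^+ 2 * (\sum_y P x y) - 2 * (pi x * (f x * kernel_op f x))
        + \sum_y pi x * P x y * f y ^+ 2.
    rewrite /kernel_op !mulr_sumr -sumrB -big_split.
    by apply: eq_bigr => y _ /=; ring.
  over.
rewrite big_split sumrB /= exchange_big /=.
under [X in _ + X]eq_bigr => y _ do rewrite -mulr_suml P_stat.
under eq_bigr => x _ do rewrite P_sum mulr1.
rewrite -mulr_sumr; ring.
Qed.

Lemma kernel_op_mean f : \sum_x pi x * kernel_op f x = \sum_x pi x * f x.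
Proof.
under eq_bigr => x _ do rewrite mulr_sumr.
rewrite exchange_big /=; apply: eq_bigr => y _.
under eq_bigr => x _ do rewrite mulrA.
by rewrite -mulr_suml P_stat.
Qed.

(* Writing P = (1 + Q) / 2 with Q stochastic, the claim is that Q contracts
   the L2 norm. *)
Lemma pair_variance_kernel_op f :
  pair_variance (kernel_op f) <= pair_variance f - dirichlet f.
Proof.
rewrite !pair_varianceE dirichletE kernel_op_mean.
pose Q x y := 2 * P x y - (x == y)%:R.
have sum_eq x (g : T -> R) : \sum_y (x == y)%:R * g y = g x.
  rewrite (bigD1 x) //= eqxx mul1r big1 ?addr0 // => y.
  by rewrite eq_sym => /negPf->; rewrite mul0r.
have Q_ge0 x y : 0 <= Q x y.
  rewrite /Q; have := P_lazy x; have := P_ge0 x y.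
  by case: eqP => [<-|_] /=; lra.
have Q_sum x : \sum_y Q x y = 1.
  rewrite sumrB -mulr_sumr P_sum.
  have := sum_eq x (fun=> 1); under eq_bigr do rewrite mulr1.
  by move=> ->; lra.
have QE x : \sum_y Q x y * f y = 2 * kernel_op f x - f x.
  under eq_bigr do rewrite /Q mulrBl -mulrA.
  by rewrite sumrB sum_eq -mulr_sumr.
have : \sum_x pi x * (2 * kernel_op f x - f x) ^+ 2 <= \sum_x pi x * f x ^+ 2.
  apply: (@le_trans _ _ (\sum_x pi x * \sum_y Q x y * f y ^+ 2)).
    apply: ler_sum => x _; rewrite ler_pM2l // -QE; exact: sqr_sum_le.
  under eq_bigr do rewrite mulr_sumr.
  rewrite exchange_big /=; apply: ler_sum => y _.
  under eq_bigr do rewrite mulrA; rewrite -mulr_suml.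
  apply: ler_wpM2r; first exact: sqr_ge0.
  rewrite /Q; under eq_bigr do rewrite mulrBr eq_sym [_ * (_ == _)%:R]mulrC mulrCA.
  rewrite sumrB sum_eq -mulr_sumr P_stat; lra.
(* Expanding the square turns the contraction into E (Pf)^2 <= E (f Pf), which is the claim up to
   terms common to both sides. *)
have -> : \sum_x pi x * (2 * kernel_op f x - f x) ^+ 2
   = 4 * (\sum_x pi x * kernel_op f x ^+ 2)
     - 4 * (\sum_x pi x * (f x * kernel_op f x)) + \sum_x pi x * f x ^+ 2.
  rewrite !mulr_sumr -sumrB -big_split; apply: eq_bigr => x _ /=; ring.
lra.
Qed.

Lemma stepS t x y : step P t.+1 x y = \sum_z step P t x z * P z y.
Proof.
rewrite /step exprSr mxE (reindex enum_rank) /=; last first.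
  by exists enum_val => z _; rewrite ?enum_rankK ?enum_valK.
by apply: eq_bigr => z _; rewrite mxE !enum_rankK.
Qed.

(** Reversibility makes the density of P^t(x, .) with respect to [pi] evolve under the kernel
    operator itself, started from the density of the point mass at [x]. *)
Lemma stepE t x y :
  step P t x y = pi y * iter t kernel_op (fun z => (x == z)%:R / pi x) y.
Proof.
elim: t y => [|t IH] y.
  rewrite /step expr0 mxE (inj_eq enum_rank_inj) /=.
  case: eqP => [<-|_]; last by rewrite mul0r mulr0.
  by rewrite mul1r divff // gt_eqF.
rewrite stepS iterS {2}/kernel_op mulr_sumr; apply: eq_bigr => z _.
by rewrite IH [RHS]mulrA -P_rev; ring.
Qed.

Section Poincare.
Variable rho : R.
Hypothesis rho_ge1 : 1 <= rho.
Hypothesis poincare : forall f, pair_variance f <= rho * dirichlet f.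

Let rho_gt0 : 0 < rho. Proof. exact: lt_le_trans rho_ge1. Qed.

(** One step removes the Dirichlet form, which by the Poincare inequality is at least a fraction
    1/rho of the variance. *)
Lemma pair_variance_decay t f :
  pair_variance (iter t kernel_op f) <= (1 - rho^-1) ^+ t * pair_variance f.
Proof.
elim: t => [|t IH]; first by rewrite expr0 mul1r.
rewrite iterS exprS -mulrA; apply: le_trans (pair_variance_kernel_op _) _.
apply: (@le_trans _ _ ((1 - rho^-1) * pair_variance (iter t kernel_op f))).
  by rewrite mulrBl mul1r lerB // mulrC ler_pdivrMr // mulrC.
by apply: ler_wpM2l IH; rewrite subr_ge0 invf_le1.
Qed.

(** Total variation is half the L1(pi) distance of the density from 1. By Cauchy-Schwarz its square
    is at most a quarter of the variance, which starts below 1 / pi(x). *)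
Lemma tv_dist_step t x :
  tv_dist (step P t x) pi ^+ 2 <= 4^-1 * ((1 - rho^-1) ^+ t / pi x).
Proof.
set f0 := fun z => (x == z)%:R / pi x.
have sum_eq (g : T -> R) : \sum_y pi y * ((x == y)%:R / pi x * g y) = g x.
  rewrite (bigD1 x) //= eqxx big1 ?addr0.
    by rewrite mul1r mulrA divff ?mul1r // gt_eqF.
  by move=> y; rewrite eq_sym => /negPf->; rewrite !mul0r mulr0.
have mean0 : \sum_y pi y * f0 y = 1.
  by have := sum_eq (fun=> 1); under eq_bigr do rewrite mulr1.
have var0 : pair_variance f0 <= 2 * (pi x)^-1.
  rewrite pair_varianceE mean0.
  have -> : \sum_y pi y * f0 y ^+ 2 = f0 x by rewrite -[RHS]sum_eq.
  by rewrite /f0 eqxx mul1r; lra.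
set f := iter t kernel_op f0.
have meant : \sum_y pi y * f y = 1.
  by rewrite /f; elim: t @f => //= t IH; rewrite kernel_op_mean.
have tvE : tv_dist (step P t x) pi = 2^-1 * \sum_y pi y * `|f y - 1|.
  congr (_ * _); apply: eq_bigr => y _.
  by rewrite stepE -/f0 -/f -{2}[pi y]mulr1 -mulrBr normrM (gtr0_norm (pi_gt0 y)).
have : (\sum_y pi y * `|f y - 1|) ^+ 2 <= 2^-1 * pair_variance f.
  apply: le_trans (sqr_sum_le _ _ pi_sum) _; first by move=> y; apply: ltW.
  under eq_bigr do rewrite real_normK ?num_real //.
  have -> : \sum_y pi y * (f y - 1) ^+ 2
      = \sum_y pi y * f y ^+ 2 - 2 * (\sum_y pi y * f y) + \sum_y pi y.
    rewrite !mulr_sumr -sumrB -big_split; apply: eq_bigr => y _ /=; ring.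
  rewrite pair_varianceE meant pi_sum; lra.
have := pair_variance_decay t f0; rewrite -/f tvE exprMn => decay.
have : (1 - rho^-1) ^+ t * pair_variance f0 <= (1 - rho^-1) ^+ t * (2 * (pi x)^-1).
  by apply: ler_wpM2l var0; rewrite exprn_ge0 // subr_ge0 invf_le1.
nra.
Qed.

(** Since 1 - 1/rho <= exp(-1/rho), a time t >= rho (c + 2 ln(1/eps)) makes (1 - 1/rho)^t at most
    exp(-c) eps^2, which beats the initial 1 / pi(x). The summand 1 pays for rounding the time up to
    an integer. *)
Lemma mixing_time_poincare c eps :
  0 <= c -> (forall x, expR (- c) <= pi x) -> 0 < eps -> eps <= 1 ->
  (mixing_time P pi eps <= (rho * (c + 2 * ln (1 / eps)) + 1)%:E)%E.
Proof.
move=> c_ge0 pi_ge eps_gt0 eps_le1; set a := rho * _.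
have lnV : ln (1 / eps) = - ln eps by rewrite div1r lnV ?posrE.
have ln_le0 : ln eps <= 0 by apply: ln_le0.
have a_ge0 : 0 <= a.
  by apply: mulr_ge0; [exact: ltW | rewrite lnV; lra].
pose t := (Num.truncn a).+1.
have t_gt : a < t%:R by rewrite /t; have /andP[] := truncn_itv a_ge0.
have t_le : t%:R <= a + 1.
  by rewrite /t -natr1 lerD2r; have /andP[] := truncn_itv a_ge0.
rewrite /mixing_time; apply/bigmax_leP; split => [|x _]; first exact: leNye.
apply: (@le_trans _ _ (t%:R%:E)); last by rewrite lee_fin.
apply: ereal_inf_lbound; exists t => //=.
have tv_ge0 : 0 <= tv_dist (step P t x) pi.
  by rewrite mulr_ge0 // sumr_ge0.
rewrite -ler_sqr ?nnegrE ?(ltW eps_gt0) //.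
apply: le_trans (tv_dist_step t x) _.
have q_le : (1 - rho^-1) ^+ t <= expR (- (c + 2 * ln (1 / eps))).
  apply: (@le_trans _ _ (expR (- rho^-1) ^+ t)).
    apply: lerXn2r; rewrite ?nnegrE ?expR_ge0 ?subr_ge0 ?invf_le1 //.
    exact: expR_ge1Dx.
  rewrite -expRM_natl ler_expR mulrN lerN2.
  by rewrite ler_pdivlMr // mulrC ltW.
have : expR (- (c + 2 * ln (1 / eps))) = expR (- c) * eps ^+ 2.
  rewrite lnV opprD mulrN opprK expRD; congr (_ * _).
  by rewrite expRM_natl lnK ?posrE.
move=> qE; rewrite qE in q_le.
have : (1 - rho^-1) ^+ t / pi x <= eps ^+ 2.
  rewrite ler_pdivrMr //; apply: le_trans q_le _.
  by rewrite mulrC ler_pM2l ?exprn_gt0.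
have := sqr_ge0 eps; lra.
Qed.

End Poincare.

End LazyReversibleChain.

(** * Weights and vertex cuts *)

(** This serves to give every edge that is cut off on its own the same weight, that of
    [single_edge]. *)
Lemma isomorphic_complete (G H : sgraph) :
  #|G| = #|H| -> (forall x y : G, adj x y = (x != y)) ->
  (forall x y : H, adj x y = (x != y)) -> isomorphic G H.
Proof.
move=> GH Gadj Hadj.
pose f (x : G) : H := enum_val (cast_ord GH (enum_rank x)).
pose g (y : H) : G := enum_val (cast_ord (esym GH) (enum_rank y)).
have fK : cancel f g by move=> x; rewrite /f /g enum_valK cast_ordK enum_rankK.
have gK : cancel g f by move=> x; rewrite /f /g enum_valK cast_ordKV enum_rankK.
exists f; first by exists g.
by move=> x y; rewrite Gadj Hadj (inj_eq (can_inj fK)).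
Qed.

Lemma single_edge_subproof :
  [forall e in [set [set: bool]], #|e| == 2%N].
Proof. by apply/forall_inP => e; rewrite inE => /eqP->; rewrite cardsT card_bool. Qed.

Definition single_edge : sgraph := SGraph single_edge_subproof.

Lemma adj_single_edge (x y : single_edge) : adj x y = (x != y).
Proof.
rewrite /adj /= inE; apply/eqP/idP => [/setP xy|xy].
  by apply/eqP => xyE; have := xy (~~ x); rewrite xyE !inE; case: (y).
by apply/setP => z; rewrite !inE; case: x y z xy => [] [] [].
Qed.

Lemma card_edge (G : sgraph) (e : edge G) : #|val e| = 2.
Proof. by apply/eqP; move/forall_inP: (edgesP G); apply; apply: valP. Qed.

Lemma edge_pair (G : sgraph) (e : edge G) (x y : G) :
  x \in val e -> y \in val e -> x != y -> val e = [set x; y].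
Proof.
move=> xe ye xy; apply/esym/eqP; rewrite eqEcard cards2 xy.
have /forall_inP/(_ _ (valP e))/eqP-> := edgesP G.
by rewrite leqnn andbT; apply/subsetP => z; rewrite !inE => /orP[] /eqP->.
Qed.

Section Front.
Variable G : sgraph.
Implicit Types (A X I F : {set edge G}) (e : edge G).

Definition touch A : {set G} := \bigcup_(e in A) val e.

Definition front A : {set G} := touch A :&: touch (~: A).

Lemma touchP A x : reflect (exists2 e, e \in A & x \in val e) (x \in touch A).
Proof. exact: bigcupP. Qed.

(* The state reached from I on the way to F once the edges of A are treated. *)
Definition mix A I F : {set edge G} := (F :&: A) :|: (I :\: A).

Lemma in_mix A I F e :
  (e \in mix A I F) = if e \in A then e \in F else e \in I.
Proof. by rewrite !inE; case: (e \in A); rewrite ?andbT ?andbF ?orbF. Qed.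

Lemma mix_setI A I F : mix A I F :&: A = F :&: A.
Proof. by apply/setP => e; rewrite !in_setI in_mix; case: (e \in A); rewrite ?andbF. Qed.

Lemma mix_setD A I F : mix A I F :&: ~: A = I :&: ~: A.
Proof.
by apply/setP => e; rewrite !in_setI in_setC in_mix; case: (e \in A); rewrite ?andbF.
Qed.

Lemma mixK A : involutive (fun p => (mix A p.1 p.2, mix A p.2 p.1)).
Proof.
move=> [I F] /=; congr pair; apply/setP => e; rewrite !in_mix; by case: (e \in A).
Qed.

End Front.

Section Weights.
Variables (R : realType) (w : sgraph -> R) (lambda : R).
Hypothesis w_graph : graph_function w.
Hypothesis w_pos : forall G : sgraph, 0 < w G.
Hypothesis lambda_pos : 0 < lambda.
Hypothesis w_mult : lambda_multiplicative lambda w.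

Local Notation L := (lhat lambda).

Lemma lhat_ge1 : 1 <= L.
Proof.
rewrite /lhat le_max; have [//|l1] := leP 1 lambda.
by rewrite invr_ge1 ?unitfE ?gt_eqF // ltW.
Qed.

Let L_gt0 : 0 < L. Proof. exact: lt_le_trans lhat_ge1. Qed.

Section Spanning.
Variable G : sgraph.
Implicit Types (A X I F : {set edge G}) (e : edge G) (U : {set G}).

(** Multiplicativity on (V, X) yields subgraphs over an edge type depending on [X]; this lemma and
    the next move their weights back to edge sets of [G]. *)
Lemma w_subgraph_spanning X U (F : {set edge (spanning X)}) F' :
  val @: F = val @: F' -> w (@subgraph (spanning X) U F) = w (subgraph U F').
Proof.
move=> FF'; apply: w_graph; exists id; first by exists id.
by move=> x y; rewrite /adj !inE /= FF'.
Qed.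

Lemma w_subgraph_setT X U (F : {set edge (spanning X)}) F' :
  U = setT -> val @: F = val @: F' ->
  w (@subgraph (spanning X) U F) = w (spanning F').
Proof.
move=> UT FF'; apply: w_graph; exists val.
  have inU x : x \in U by rewrite UT inE.
  exists (fun x => Sub x (inU x)) => x; last by rewrite SubK.
  by apply: val_inj; rewrite SubK.
by move=> x y; rewrite /adj inE imsetU1 imset_set1 /= -FF'.
Qed.

Lemma w_subgraph_edge X (U : {set G}) (F : {set edge (spanning X)}) :
  #|U| = 2 -> val @: F = [set U] -> w (@subgraph (spanning X) U F) = w single_edge.
Proof.
move=> U2 FU; apply/w_graph/isomorphic_complete.
- by rewrite card_sig U2 card_bool.
- move=> x y; rewrite /adj inE imsetU1 imset_set1 /= FU inE.
  apply/eqP/idP => [xyU|xy].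
    by apply/eqP => xy; move: U2; rewrite -xyU xy setUid cards1.
  apply/eqP; rewrite eqEcard U2 cards2 (inj_eq val_inj) xy.
  rewrite andbT; apply/subsetP => z; rewrite !inE => /orP[] /eqP->; apply: valP.
- exact: adj_single_edge.
Qed.

(** The cut [front A] does not depend on [X], and the two sides of (V, X) see only the edges of [X]
    inside and outside [A]. Having the same two functions for every [X] is what lets [w_mix]
    recombine the factors. *)
Lemma w_cut A : exists a1 a2 : {set edge G} -> R,
  forall X, [/\ 0 < a1 (X :&: A), 0 < a2 (X :&: ~: A) &
    L ^- #|front A| <= a1 (X :&: A) * a2 (X :&: ~: A) / w (spanning X)
      <= L ^+ #|front A|].
Proof.
(* Vertices on no edge fall into [V1], so [V1], [front A] and [V2] cover all of V. *)
pose V1 := ~: touch (~: A); pose V2 := touch (~: A) :\: touch A.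
exists (fun X => w (subgraph (V1 :|: front A) X)).
exists (fun X => w (subgraph (V2 :|: front A) X)) => X; split=> //.
pose EX : {set edge (spanning X)} := [set e | (val e : {set G}) \in val @: A].
have EXP (e : edge (spanning X)) : exists2 f, f \in X & val e = val f.
  by have /imsetP[f fX ->] := valP e; exists f.
have EX1 : val @: EX = val @: (X :&: A).
  apply/setP => u; apply/imsetP/imsetP => [[e] | [f]].
    rewrite inE => /imsetP[f fA ef] ->; have [g gX eg] := EXP e.
    exists f => //; rewrite inE fA andbT.
    by have /val_inj-> : val f = val g by rewrite -ef.
  rewrite inE => /andP[fX fA ->].
  have fE : val f \in edges (spanning X) by apply: imset_f.
  by exists (Sub (val f) fE); rewrite // inE /= imset_f.
have EX2 : val @: (~: EX) = val @: (X :&: ~: A).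
  apply/setP => u; apply/imsetP/imsetP => [[e] | [f]].
    rewrite !inE => eA ->; have [g gX eg] := EXP e.
    exists g => //; rewrite !inE gX; apply: contra eA => gA.
    by rewrite eg imset_f.
  rewrite !inE => /andP[fX fA ->].
  have fE : val f \in edges (spanning X) by apply: imset_f.
  exists (Sub (val f) fE) => //; rewrite !inE /=.
  by apply: contra fA => /imsetP[g gA /val_inj->].
rewrite -(w_subgraph_spanning _ EX1) -(w_subgraph_spanning _ EX2).
apply: (w_mult (G := spanning X)).
  split.
  - by apply/setP => v; rewrite /V1 /V2 !inE;
      case: (v \in touch A); case: (v \in touch (~: A)).
  - by split; rewrite -setI_eq0; apply/eqP/setP => v;
      rewrite /V1 /V2 !inE; case: (v \in touch A); case: (v \in touch (~: A)).
  - move=> x y; rewrite !inE => xA /andP[yA _].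
    apply/negP => /imsetP[f fX xyf]; case: (boolP (f \in A)) => fA.
      by case/touchP: yA; exists f; rewrite // -xyf !inE eqxx orbT.
    by case/touchP: xA; exists f; rewrite ?inE // -xyf !inE eqxx.
split.
- by rewrite setUCr.
- by rewrite -setI_eq0 setICr.
- move=> e; rewrite inE => /imsetP[f fA ef]; rewrite ef -setI_eq0.
  apply/eqP/setP => v; rewrite !inE; apply/negP => /and3P[vf vA _].
  by case/touchP: vA; exists f.
- move=> e; rewrite inE => eA; have [g gX eg] := EXP e.
  rewrite eg -setI_eq0; apply/eqP/setP => v; rewrite !inE.
  apply/negP => /andP[vg] /touchP; apply; exists g => //.
  by rewrite inE; apply: contra eA => gA; rewrite inE eg imset_f.
Qed.

(** The two mixed states have the same four factors as [I] and [F], paired differently; each of the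
    four weights costs one [L ^+ b]. *)
Lemma w_mix A I F b : (#|front A| <= b)%N ->
  w (spanning I) * w (spanning F)
  <= L ^+ (4 * b) * (w (spanning (mix A I F)) * w (spanning (mix A F I))).
Proof.
move=> Ab; have [a1 [a2 a12]] := w_cut A.
have Lb : L ^+ #|front A| <= L ^+ b by apply: ler_weXn2l; rewrite ?lhat_ge1.
have ub X : a1 (X :&: A) * a2 (X :&: ~: A) <= L ^+ b * w (spanning X).
  have [_ _ /andP[_]] := a12 X; rewrite ler_pdivrMr // => /le_trans; apply.
  by rewrite ler_pM2r.
have lb X : w (spanning X) <= L ^+ b * (a1 (X :&: A) * a2 (X :&: ~: A)).
  have [a1_gt0 a2_gt0 /andP[+ _]] := a12 X.
  rewrite ler_pdivlMr // mulrC ler_pdivrMr ?exprn_gt0 // => /le_trans; apply.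
  by rewrite mulrC ler_pM2r ?mulr_gt0.
have a1_gt0 X : 0 < a1 (X :&: A) by have [] := a12 X.
have a2_gt0 X : 0 < a2 (X :&: ~: A) by have [] := a12 X.
have := ub (mix A I F); have := ub (mix A F I); rewrite !mix_setI !mix_setD.
move=> ubFI ubIF.
apply: (@le_trans _ _ ((L ^+ b * (a1 (I :&: A) * a2 (I :&: ~: A)))
    * (L ^+ b * (a1 (F :&: A) * a2 (F :&: ~: A))))).
  by apply: ler_pM; [exact: ltW | exact: ltW | exact: lb | exact: lb].
apply: (@le_trans _ _ ((L ^+ b) ^+ 2 * ((L ^+ b * w (spanning (mix A I F)))
    * (L ^+ b * w (spanning (mix A F I)))))).
  rewrite [leLHS](_ : _ = (L ^+ b) ^+ 2 *
    ((a1 (F :&: A) * a2 (I :&: ~: A)) * (a1 (I :&: A) * a2 (F :&: ~: A))));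
    last by ring.
  rewrite ler_pM2l ?exprn_gt0 //.
  by apply: ler_pM => //; apply: mulr_ge0; apply: ltW.
by rewrite mulnC exprM le_eqVlt; apply/orP; left; apply/eqP; ring.
Qed.

(** Bounds the effect of toggling one edge: [L ^+ 2] pays for the cut at its two ends, the maximum
    for the weight of the edge split off. *)
Definition edge_ratio := L ^+ 2 * Num.max (w single_edge) (w single_edge)^-1.

Lemma edge_ratio_ge1 : 1 <= edge_ratio.
Proof.
rewrite /edge_ratio -[1]mulr1; apply: ler_pM => //.
  by rewrite exprn_ege1 // lhat_ge1.
rewrite le_max; have [//|l1] := leP 1 (w single_edge).
by rewrite invr_ge1 ?unitfE ?gt_eqF // ltW.
Qed.

(** Cutting at the two ends of [e], with [V2] empty and [e] alone in [E2], compares (V, X) with (V,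
    X - e) times a single edge. *)
Lemma w_setD1 X e : e \in X ->
  w (spanning X) <= edge_ratio * w (spanning (X :\ e))
  /\ w (spanning (X :\ e)) <= edge_ratio * w (spanning X).
Proof.
move=> eX.
have eE : val e \in edges (spanning X) by apply: imset_f.
pose e' : edge (spanning X) := Sub (val e) eE.
have e2 := card_edge e.
have := w_mult (G := spanning X) (K := val e) (V1 := ~: val e) (V2 := set0)
  (E1 := ~: [set e']) (E2 := [set e']).
have -> : w (@subgraph (spanning X) (~: val e :|: val e) (~: [set e']))
    = w (spanning (X :\ e)).
  apply: w_subgraph_setT; first by rewrite setUC setUCr.
  apply/setP => u; apply/imsetP/imsetP => [[f] | [f]].
    rewrite !inE => fe ->; have /imsetP[g gX fg] := valP f.
    exists g => //; rewrite !inE gX andbT; apply: contra fe => /eqP ge.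
    by apply/eqP/val_inj; rewrite /= fg ge.
  rewrite !inE => /andP[fe fX ->].
  have fE : val f \in edges (spanning X) by apply: imset_f.
  exists (Sub (val f) fE) => //; rewrite !inE; apply: contra fe => /eqP/(congr1 val)/= fe.
  exact/eqP/val_inj.
rewrite (w_subgraph_edge (U := set0 :|: val e)); last 2 first.
- by rewrite set0U.
- by rewrite set0U imset_set1.
rewrite e2 => cut.
have {cut} /andP[] : L ^- 2 <= w (spanning (X :\ e)) * w single_edge / w (spanning X)
   <= L ^+ 2.
  apply: cut.
    split; first by rewrite setU0 setUC setUCr.
      by split; rewrite -setI_eq0 ?setI0 // setIC setICr.
    by move=> x y _; rewrite inE.
  split.
  - by rewrite setUC setUCr.
  - by rewrite -setI_eq0 setIC setICr.
  - by move=> f _; rewrite -setI_eq0 setI0.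
  - by move=> f; rewrite inE => /eqP->; rewrite -setI_eq0 setICr.
rewrite ler_pdivlMr // mulrC ler_pdivrMr ?exprn_gt0 // ler_pdivrMr // => lb ub.
rewrite /edge_ratio; set M := Num.max _ _.
have M_ge0 : 0 <= M by rewrite le_max (ltW (w_pos _)).
have L2 : 0 < L ^+ 2 by rewrite exprn_gt0.
split.
  apply: (le_trans lb); rewrite mulrC -mulrA ler_pM2l // mulrC ler_pM2r //.
  by rewrite le_max lexx.
rewrite -(ler_pM2r (w_pos single_edge)) (le_trans ub) //.
rewrite [leRHS](_ : _ = (L ^+ 2 * w (spanning X)) * (M * w single_edge)); last by ring.
rewrite -[leLHS]mulr1 ler_pM2l ?mulr_gt0 //.
by rewrite -ler_pdivrMr // mul1r le_max lexx orbT.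
Qed.

Lemma w_flip X e : w (spanning (flip X e)) <= edge_ratio * w (spanning X).
Proof.
case: (boolP (e \in X)) => eX.
  have -> : flip X e = X :\ e.
    by apply/setP => f; rewrite flipE !inE; case: eqP => [->|]; rewrite ?eX.
  by have [] := w_setD1 eX.
have -> : flip X e = e |: X.
  by apply/setP => f; rewrite flipE !inE; case: eqP => [->|]; rewrite ?eX.
have := w_setD1 (X := e |: X) (e := e); rewrite setU1K // setU11.
by case.
Qed.

End Spanning.
End Weights.

(** * Edge orders with small fronts *)

Lemma cat_eq_cat (T : Type) (s r s1 s2 : seq T) : s ++ r = s1 ++ s2 ->
  (exists q, s = s1 ++ q /\ s2 = q ++ r) \/ (exists q, s1 = s ++ q /\ r = q ++ s2).
Proof.
elim: s s1 => [|x s IH] [|y s1] /=.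
- by move=> ->; left; exists [::].
- by move=> ->; right; exists (y :: s1).
- by move=> <-; left; exists (x :: s).
- move=> [-> /IH[[q [-> ->]]|[q [-> ->]]]]; first by left; exists q.
  by right; exists q.
Qed.

Lemma adj_sym (G : sgraph) : symmetric (@adj G).
Proof. by move=> x y; rewrite /adj setUC. Qed.

Lemma adj_irrefl (G : sgraph) (x : G) : adj x x = false.
Proof.
apply/negP => xx; have := card_edge (exist (fun e => e \in edges G) [set x; x] xx).
by rewrite /= setUid cards1.
Qed.

(** * Branches, bridges and self-maps of a finite tree *)

Section Trees.
Variable T : sgraph.
Hypothesis T_tree : is_tree T.

(** Its connected classes, apart from [t] alone, are the branches of the tree at [t]. *)
Definition avoid (t : T) := [rel a b : T | [&& adj a b, a != t & b != t]].

Lemma avoid_sym t : connect_sym (avoid t).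
Proof. by apply: sym_connect_sym => a b /=; rewrite adj_sym [(a != _) && _]andbC. Qed.

(** On a simple path from [x] to [t], the last node before [t] serves as [s], and the path up to it
    misses [t]. *)
Lemma tree_branch (t x : T) :
  x != t -> exists2 s, adj t s & connect (avoid t) x s.
Proof.
have [_ /(_ x t)/connectP[p xp ->] _] := T_tree.
case/shortenP: xp => q; case/lastP: q => [|q s]; first by rewrite eqxx.
rewrite rcons_path last_rcons -rcons_cons rcons_uniq => /andP[xq sq] /andP[sN _] _ _.
exists (last x q); first by rewrite adj_sym.
apply/connectP; exists q => //.
have qN : all (predC1 s) (x :: q).
  by apply/allP => z zq /=; apply: contraNneq sN => <-.
by apply: (sub_in_path _ qN xq) => a b; rewrite !inE /= => -> -> ->.
Qed.

(** A simple path between the ends that avoids their edge would close up with it to a cycle of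
    length at least 3. *)
Lemma tree_bridge (s t : T) : adj s t ->
  ~~ connect [rel a b | adj a b && ([set a; b] != [set s; t])] s t.
Proof.
move=> st; apply/negP => /connectP[p sp tE].
have [_ _ /(_ _)] := T_tree; move: tE; case/shortenP: sp => q sq uq _ tE.
move=> /(_ (s :: q)); rewrite /ucycle uq andbT /= rcons_path -tE adj_sym st andbT.
move=> /(_ (sub_path _ sq)) size_q.
have {size_q} : (size (s :: q) < 3)%N by apply: size_q => a b /= /andP[].
move: sq tE; case: q uq => [|a [|//]] _ /=.
  by move=> _ ts; rewrite ts adj_irrefl in st.
by move=> + ta _; rewrite -ta eqxx andbF.
Qed.

(** Iterating [h] runs into a cycle along edges; a tree has none of length 3 or more, and length 1
    would be a loop. *)
Lemma tree_fun_swap (h : T -> T) :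
  (forall t, adj t (h t)) -> exists t, h (h t) = t.
Proof.
move=> hadj; have [/card_gt0P[t0 _] _ acyclic] := T_tree.
have /trajectP[i i_lt iE] := looping_order h t0.
set x := iter i h t0 in iE.
have xcyc : exists k, iter k.+1 h x = x.
  exists (order h t0 - i).-1; rewrite prednK ?subn_gt0 // /x -iterD subnK //.
  exact: ltnW.
(* A return to [x] (item 3) implies that the orbit of [x] is a cycle of [h] (item 0) and that
   [order h x] is a period (item 4). *)
have /(orbitPcycle 3%N 0%N) cyc := xcyc; have /(orbitPcycle 3%N 4%N) /= itx := xcyc.
have := acyclic (orbit h x); rewrite /ucycle orbit_uniq andbT size_orbit => size_lt.
have {size_lt} : (order h x < 3)%N.
  by apply: size_lt; apply: sub_cycle cyc => a b /eqP <-.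
move: itx (order_gt0 h x); case: (order h x) => [|[|[|//]]] //= hx _ _.
  by have := hadj x; rewrite hx adj_irrefl.
by exists x.
Qed.

End Trees.

Section EdgeOrder.
Variable G : sgraph.
Implicit Types (U A B S : {set G}) (s : seq (edge G)) (e : edge G).

Definition touched s : {set G} := [set v | has (fun e => v \in val e) s].

Lemma touchedP s v : reflect (exists2 e, e \in s & v \in val e) (v \in touched s).
Proof. by rewrite inE; apply: hasP. Qed.

(** Edges with one end outside [U] are listed too, but only front vertices inside [U] are counted:
    those outside are charged to the bags removed at outer levels of the recursion. *)
Definition thin_order b U s := [/\ uniq s,
  forall e, (e \in s) = ~~ [disjoint val e & U] &
  forall s1 s2, s = s1 ++ s2 ->
    (#|U :&: touched s1 :&: touched s2| <= b)%N].

Definition thin b U :=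
  (exists s, thin_order b U s)
  /\ (#|[set e : edge G | val e \subset U]| <= b * #|U|)%N.

Lemma meetsP e U : reflect (exists2 v, v \in val e & v \in U) (~~ [disjoint val e & U]).
Proof.
rewrite -setI_eq0; apply: (iffP (set0Pn _)) => -[v].
  by rewrite inE => /andP[]; exists v.
by move=> ve vU; exists v; rewrite inE ve.
Qed.

Lemma touched_cat s1 s2 : touched (s1 ++ s2) = touched s1 :|: touched s2.
Proof. by apply/setP => v; rewrite !inE has_cat. Qed.

Lemma thin_leq b c U : (b <= c)%N -> thin b U -> thin c U.
Proof.
move=> bc [[s [us sU sb]] eb]; split; last first.
  by apply: leq_trans eb _; rewrite leq_mul2r bc orbT.
by exists s; split=> // s1 s2 /sb /leq_trans; apply.
Qed.

Lemma thin0 b : thin b set0.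
Proof.
split; last first.
  rewrite (_ : [set _ | _] = set0) ?cards0 //; apply/setP => e; rewrite !inE subset0.
  by apply/negP => /eqP e0; have := card_edge e; rewrite e0 cards0.
exists [::]; split=> //.
  by move=> e; rewrite -setI_eq0 setI0 eqxx.
by move=> s1 s2 _; rewrite set0I set0I cards0.
Qed.

(** The two orders are concatenated. No edge meets both sets, so a cut point inside one block leaves
    each vertex of the other set touched on at most one side. *)
Lemma thinU b A B : [disjoint A & B] ->
  (forall x y, x \in A -> y \in B -> ~~ adj x y) ->
  thin b A -> thin b B -> thin b (A :|: B).
Proof.
move=> dAB nAB [[sA [uA sAE sAb]] eA] [[sB [uB sBE sBb]] eB].
have no_cross e x y : x \in val e -> x \in A -> y \in val e -> y \in B -> False.
  move=> xe xA ye yB; have xy : x != y.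
    by apply: contraTneq yB => <-; rewrite (disjointFr dAB xA).
  by have := nAB x y xA yB; rewrite /adj -(edge_pair xe ye xy) (valP e).
have tA v : v \in B -> v \notin touched sA.
  move=> vB; apply/negP => /touchedP[e + ve]; rewrite sAE => /meetsP[x xe xA].
  exact: no_cross xe xA ve vB.
have tB v : v \in A -> v \notin touched sB.
  move=> vA; apply/negP => /touchedP[e + ve]; rewrite sBE => /meetsP[x xe xB].
  exact: no_cross ve vA xe xB.
split; last first.
  pose inside (X : {set G}) := [set e : edge G | val e \subset X].
  apply: (@leq_trans #|inside A :|: inside B|); last first.
    rewrite cardsU (cardsU A) (eqP (_ : A :&: B == set0)) ?setI_eq0 // cards0 subn0.
    by rewrite mulnDr; apply: leq_trans (leq_subr _ _) _; apply: leq_add.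
  apply/subset_leq_card/subsetP => e; rewrite !inE => /subsetP eAB.
  apply/orP; case: (boolP (val e \subset B)) => [|/subsetPn[x xe xB]]; [by right|left].
  have xA : x \in A by have := eAB x xe; rewrite inE (negPf xB) orbF.
  apply/subsetP => y ye; have := eAB y ye; rewrite inE => /orP[//|yB].
  by case: (no_cross e x y).
exists (sA ++ sB); split.
- rewrite cat_uniq uA uB andbT /=; apply/hasPn => e; rewrite sAE sBE.
  move=> /meetsP[y ye yB]; apply/negP => /meetsP[x xe xA].
  exact: no_cross xe xA ye yB.
- move=> e; rewrite mem_cat sAE sBE; apply/orP/meetsP => [[]/meetsP[x xe xX]|[x xe]].
  + by exists x; rewrite // inE xX.
  + by exists x; rewrite // inE xX orbT.
  + by rewrite inE => /orP[] xX; [left|right]; apply/meetsP; exists x.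
move=> s1 s2 /cat_eq_cat[[s2' [sAE' s2E]]|[s1' [s1E sBE']]].
  apply: leq_trans (sAb s1 s2' sAE'); apply/subset_leq_card/subsetP => v.
  rewrite s2E touched_cat !in_setI !in_setU => /andP[/andP[vAB v1] v2].
  have vA : v \in A.
    by case/orP: vAB => // /tA; rewrite sAE' touched_cat in_setU v1.
  by rewrite vA v1; case/orP: v2 => // v2; rewrite (negPf (tB v vA)) in v2.
apply: leq_trans (sBb s1' s2 sBE'); apply/subset_leq_card/subsetP => v.
rewrite s1E touched_cat !in_setI !in_setU => /andP[/andP[vAB v1] v2].
have vB : v \in B.
  by case/orP: vAB => // /tB; rewrite sBE' touched_cat in_setU v2 orbT.
by rewrite vB v2 andbT; case/orP: v1 => // v1; rewrite (negPf (tA v vB)) in v1.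
Qed.

(** The edges that meet [U] only inside [S] are appended, so the front gains vertices of [S] only.
    An edge inside [U] that meets [S] comes from a pair in S x U, which bounds the edge count. *)
Lemma thinD b U S : thin b (U :\: S) -> thin (b + #|S|) U.
Proof.
move=> [[s [us sE sb]] eb]; split; last first.
  pose F := [set e : edge G | val e \subset U & ~~ [disjoint val e & S]].
  apply: leq_trans (_ : #|[set e : edge G | val e \subset U :\: S] :|: F| <= _)%N.
    apply/subset_leq_card/subsetP => e; rewrite !inE subsetD => ->.
    by case: [disjoint _ & _].
  rewrite cardsU mulnDl; apply: leq_trans (leq_subr _ _) _; apply: leq_add.
    by apply: leq_trans eb _; rewrite leq_mul2l subset_leq_card ?subsetDl ?orbT.
  rewrite -(card_imset _ val_inj) -cardsX.
  apply: leq_trans (leq_imset_card (fun p : G * G => [set p.1; p.2]) _).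
  apply/subset_leq_card/subsetP => u /imsetP[e]; rewrite inE => /andP[eU eS] ->.
  have /meetsP[x xe xS] := eS.
  have /set0Pn[y] : val e :\ x != set0.
    by rewrite -card_gt0; have := cardsD1 x (val e); rewrite xe card_edge; lia.
  rewrite !inE => /andP[yx ye]; apply/imsetP; exists (x, y) => /=.
    by rewrite inE /= xS (subsetP eU).
  by apply: edge_pair; rewrite // eq_sym.
pose r := [seq e <- enum (edge G) | (e \notin s) && ~~ [disjoint val e & U]].
exists (s ++ r); split.
- rewrite cat_uniq us filter_uniq ?enum_uniq // andbT /=.
  by apply/hasPn => e; rewrite mem_filter => /andP[/andP[]].
- move=> e; rewrite mem_cat mem_filter mem_enum andbT.
  case: (boolP (e \in s)) => //=; rewrite sE => /meetsP[x xe].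
  by rewrite inE => /andP[_ xU]; apply/esym/meetsP; exists x.
have rU v : v \in U -> v \notin S -> v \notin touched r.
  move=> vU vS; apply/negP => /touchedP[e]; rewrite mem_filter sE => /andP[/andP[+ _] _].
  by move=> /negP eN ve; apply: eN; apply/meetsP; exists v; rewrite // inE vS.
have sub s1 s2 p q : s = p ++ q -> 
    (forall v, v \in U -> v \notin S -> v \in touched s1 -> v \in touched s2 ->
      (v \in touched p) && (v \in touched q)) ->
    (#|U :&: touched s1 :&: touched s2| <= b + #|S|)%N.
  move=> sE' H; apply: leq_trans (leq_add (sb p q sE') (leqnn _)).
  apply: (@leq_trans #|((U :\: S) :&: touched p :&: touched q) :|: S|); last first.
    by rewrite cardsU; apply: leq_subr.
  apply/subset_leq_card/subsetP => v; rewrite !in_setU !in_setI in_setD.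
  case: (boolP (v \in S)) => vS; first by rewrite orbT.
  by move=> /andP[/andP[vU v1] v2]; rewrite vU orbF /= H.
move=> s1 s2 /cat_eq_cat[[q [sE' ->]]|[q [-> rE]]].
  apply: (sub _ _ s1 q sE') => v vU vS -> /=.
  by rewrite touched_cat inE (negPf (rU v vU vS)) orbF.
(* Here the cut falls in the appended block, whose second part touches no vertex of [U] outside [S];
   splitting [s] at its end then suffices. *)
apply: (sub _ _ s [::]); first by rewrite cats0.
move=> v vU vS _ v2; have := rU v vU vS.
by rewrite rE touched_cat in_setU v2 orbT.
Qed.

(** Classes are split off one at a time; no edge joins different classes, so [thinU] keeps the same
    [b]. *)
Lemma thin_classes b U (r : rel G) : equivalence_rel r ->
  {in U &, forall x y, adj x y -> r x y} ->
  {in U, forall x, thin b [set y in U | r x y]} -> thin b U.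
Proof.
move=> req; have [m] := ubnP #|U|; elim: m U => // m IH U Um rU tU.
have [->|/set0Pn[x xU]] := eqVneq U set0; first exact: thin0.
pose C := [set y in U | r x y].
have rxx y : r y y by have [] := req y y y.
have xC : x \in C by rewrite inE xU rxx.
have CU : C \subset U by apply/subsetP => y; rewrite inE => /andP[].
have UE : U = C :|: U :\: C by rewrite -{1}(setID U C) (setIidPr CU).
have dCU : [disjoint C & U :\: C].
  rewrite -setI_eq0; apply/eqP/setP => y.
  by rewrite in_setI in_setD in_set0; case: (y \in C).
have rtrans y z : r x y -> r y z = r x z by move=> xy; have [_ ->] := req x y z.
rewrite UE; apply: thinU => //.
- move=> y z; rewrite !inE => /andP[yU xy] /andP[+ zU]; rewrite zU /=.
  apply: contra => yz; rewrite -(rtrans _ _ xy); exact: rU.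
- exact: tU.
apply: IH.
- rewrite -ltnS; apply: leq_trans Um; rewrite ltnS; apply: proper_card.
  by apply/properP; split; [apply: subsetDl | exists x; rewrite // inE xC].
- by move=> y z; rewrite !inE => /andP[_ yU] /andP[_ zU]; apply: rU.
move=> y; rewrite !inE => /andP[+ yU]; rewrite yU /= => xy.
rewrite (_ : [set _ in _ | _] = [set z in U | r y z]); first exact: tU.
apply/setP => z; rewrite !inE; case: (boolP (z \in U)); rewrite ?andbF //= andbT => zU.
case: (boolP (r y z)) => yz; rewrite ?andbF // andbT.
apply: contra xy => xz; have [_ ->] := req x z y; last exact: xz.
by have [_ <-] := req y z y.
Qed.

Section BoundedBags.
Variables (T : sgraph) (B : T -> {set G}) (k : nat).
Hypothesis B_td : tree_decomposition B.
Hypothesis B_le : forall t, (#|B t| <= k)%N.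

Variable bag : G -> T.
Hypothesis bagP : forall v, v \in B (bag v).

(** The bags containing a vertex outside [B t] are connected without passing [t], so the vertex has
    a well-defined branch; a bag holding both ends of the edge puts them on the same one. *)
Lemma avoid_adj t x y :
  x \notin B t -> y \notin B t -> adj x y -> connect (avoid t) (bag x) (bag y).
Proof.
have [_ _ edgeB connB] := B_td => xt yt /edgeB[c] /subsetP xyc.
have sub v : v \notin B t -> v \in B c -> connect (avoid t) (bag v) c.
  move=> vt vc; apply: connect_sub (connB v _ _ (bagP v) vc) => a b /= /and3P[ab va vb].
  apply: connect1; rewrite /= ab /=; apply/andP.
  by split; apply: contraNneq vt => <-.
apply: connect_trans (sub x xt _) _; first by apply: xyc; rewrite !inE eqxx.
by rewrite avoid_sym; apply: sub => //; apply: xyc; rewrite !inE eqxx orbT.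
Qed.

(* If every bag had a majority branch, following it from node to node would
   produce an edge of T both of whose sides are majority branches. *)
Lemma balanced_bag U : exists t, forall x, x \in U :\: B t ->
  (#|[set y in U :\: B t | connect (avoid t) (bag x) (bag y)]|.*2 <= #|U|)%N.
Proof.
have [T_tree _ _ _] := B_td.
pose X (t s : T) := [set y in U :\: B t | connect (avoid t) s (bag y)].
pose heavy (t s : T) := (#|U| < #|X t s|.*2)%N.
have [/existsP[t tP]|] := boolP [exists t, [forall x in U :\: B t, ~~ heavy t (bag x)]].
  by exists t => x xU; rewrite leqNgt; apply: (forall_inP tP).
rewrite negb_exists => /forallP all_heavy.
have /fin_all_exists[h hP] : forall t : T, exists s : T, adj t s && heavy t s.
  move=> t; have := all_heavy t; rewrite negb_forall_in => /exists_inP[x].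
  rewrite inE negbK => /andP[xt xU] hx.
  have /(tree_branch T_tree)[s ts xs] : bag x != t.
    by apply: contraNneq xt => <-.
  exists s; rewrite ts /heavy; apply: leq_trans hx _; rewrite leq_double.
  apply/subset_leq_card/subsetP => y; rewrite !inE => /andP[-> xy] /=.
  by apply: connect_trans xy; rewrite avoid_sym.
have [t ht] := tree_fun_swap T_tree (fun t => proj1 (andP (hP t))).
set s := h t in ht; have /andP[ts heavy_t] := hP t; have /andP[_ heavy_s] := hP s.
rewrite -/s in ts heavy_t; rewrite ht in heavy_s.
(* Both branches hold more than half of [U], so they share some [y]. The walks to [bag y] from [s]
   avoiding [t] and from [t] avoiding [s] join [s] to [t] without their edge, which is a bridge. *)
have /set0Pn[y] : X t s :&: X s t != set0.
  apply/negP => /eqP X0.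
  have : (#|X t s :|: X s t| <= #|U|)%N.
    by apply/subset_leq_card/subsetP => y; rewrite !inE => /orP[] /andP[/andP[]].
  rewrite cardsU X0 cards0 subn0; move: heavy_t heavy_s; rewrite /heavy; lia.
rewrite !inE => /andP[/andP[_ sy] /andP[_ ty]].
have st : adj s t by rewrite adj_sym.
have /negP := tree_bridge T_tree st; case.
set e := [rel a b | _].
have sub a b : connect (avoid t) a b || connect (avoid s) a b -> connect e a b.
  by case/orP; apply: connect_sub => c d /= /and3P[cd cN dN]; apply: connect1;
    rewrite /= cd /=; apply/eqP => /setP/[dup]/(_ s) + /(_ t);
    rewrite !inE !eqxx ?orbT /= ![_ == c]eq_sym ![_ == d]eq_sym (negPf cN) (negPf dN).
have e_sym : connect_sym e.
  by apply: sym_connect_sym => a b /=; rewrite adj_sym [[set a; b]]setUC.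
apply: connect_trans (sub _ _ (introT orP (or_introl sy))) _.
by rewrite e_sym; apply: sub; rewrite ty orbT.
Qed.

(** Each unit of [j] is one level: removing a balanced bag costs at most [k] and leaves classes of
    at most half the size. At [j = 0] the set is empty. *)
Lemma thin_tree_decomposition j U : (#|U| < 2 ^ j)%N -> thin (k * j) U.
Proof.
elim: j U => [|j IH] U.
  by rewrite ltnS leqn0 cards_eq0 => /eqP->; apply: thin0.
move=> Uj; have [t tP] := balanced_bag U.
apply: (@thin_leq (k * j + #|B t|)); first by rewrite mulnS addnC leq_add2r.
apply: thinD; apply: (@thin_classes _ _ (fun x y => connect (avoid t) (bag x) (bag y))).
- move=> x y z; split=> [|xy]; first exact: connect0.
  apply/idP/idP; apply: connect_trans => //.
  by rewrite avoid_sym.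
- by move=> x y; rewrite !inE => /andP[xt _] /andP[yt _]; apply: avoid_adj.
move=> x xU; apply: IH; have := tP x xU; move: Uj; rewrite expnS; lia.
Qed.

End BoundedBags.
End EdgeOrder.

Lemma treewidth_decomposition (G : sgraph) : exists (T : sgraph) (B : T -> {set G}),
  tree_decomposition B /\ forall t, (#|B t| <= treewidth G + 1)%N.
Proof.
rewrite /treewidth; case: ex_minnP => k /asboolP[T [B [B_td Bk]]] _.
exists T, B; split=> // t; rewrite -Bk addn1.
by apply: leq_trans (leqSpred _); apply: leq_bigmax.
Qed.

Lemma edge_order (G : sgraph) j (b := ((treewidth G + 1) * j)%N) : (#|G| < 2 ^ j)%N ->
  (#|edge G| <= b * #|G|)%N /\
  exists s : seq (edge G), [/\ uniq s, forall e, e \in s &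
    forall i, (#|front [set e in take i s]| <= b)%N].
Proof.
move=> Gj; have [T [B [B_td B_le]]] := treewidth_decomposition G.
have [_ /fin_all_exists[bag bagP] _ _] := B_td.
have := @thin_tree_decomposition G T B _ B_td B_le bag bagP j setT.
rewrite cardsT => /(_ Gj)[[s [us sE sb]] eb]; split.
  rewrite cardsT in eb; apply: leq_trans eb.
  by apply: subset_leq_card; apply/subsetP => e _; rewrite inE subsetT.
have sT e : e \in s.
  rewrite sE -setI_eq0 setIT -card_gt0; by rewrite card_edge.
exists s; split=> // i; apply: leq_trans (sb _ _ (esym (cat_take_drop i s))).
apply/subset_leq_card/subsetP => v; rewrite !in_setI inE /=.
move=> /andP[/touchP[e ei ve] /touchP[f fi vf]]; apply/andP; split; apply/touchedP.
  by exists e; rewrite // inE in ei.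
exists f => //; move: fi; rewrite !inE; have := sT f.
by rewrite -{1}(cat_take_drop i s) mem_cat => /orP[->|].
Qed.

(** * Canonical paths for the single bond flip chain *)

Section FlipPaths.
Variable G : sgraph.
Implicit Types (A S I F : {set edge G}) (e : edge G) (s : seq (edge G)).

(** Treating one more edge is thus a single bond flip or no move at all, so canonical paths run
    along transitions of the chain. *)
Lemma mix_setU1 A I F e : e \notin A ->
  mix (e |: A) I F =
    if (e \in I) (+) (e \in F) then flip (mix A I F) e else mix A I F.
Proof.
move=> eA; case: ifP => IF; apply/setP => x;
  rewrite ?flipE !in_mix in_setU1; case: (eqVneq x e) => [->|//] /=;
  rewrite (negPf eA); by move: IF; case: (e \in I); case: (e \in F).
Qed.

Lemma mix_set0 I F : mix set0 I F = I.
Proof. by apply/setP => x; rewrite in_mix in_set0. Qed.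

Lemma mix_setT I F : mix setT I F = F.
Proof. by apply/setP => x; rewrite in_mix in_setT. Qed.

End FlipPaths.

Section Congestion.
Variables (R : realType) (w : sgraph -> R) (G : sgraph).
Hypothesis w_pos : forall G : sgraph, 0 < w G.
Implicit Types (A S I F : {set edge G}) (e : edge G) (f : {set edge G} -> R).

Local Notation pi := (@gibbs R w G).
Local Notation P := (@bond_flip R w G).
Local Notation m := #|edge G|.

(** The minimum is 2m times the stationary flow from [S] to [flip S e]. *)
Definition flip_energy f e S :=
  Num.min (pi S) (pi (flip S e)) * (f S - f (flip S e)) ^+ 2.

Let pi_gt0 S : 0 < pi S. Proof. exact: gibbs_gt0. Qed.

Lemma flip_energy_ge0 f e S : 0 <= flip_energy f e S.
Proof. by rewrite mulr_ge0 ?sqr_ge0 // le_min !ltW. Qed.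

Lemma gibbs_accept_min S H : pi S * accept w S H = 2^-1 * Num.min (pi S) (pi H).
Proof.
rewrite /accept mulrCA minr_pMr ?ltW // mulr1; congr (_ * Num.min _ _).
by rewrite /gibbs mulrC mulrA divfK ?gt_eqF.
Qed.

Lemma dirichlet_bond_flip f :
  dirichlet P pi f = (2 * m%:R)^-1 * \sum_e \sum_S flip_energy f e S.
Proof.
rewrite exchange_big mulr_sumr; apply: eq_bigr => S _ /=.
under eq_bigr => H _ do rewrite /bond_flip mulr_sumr mulr_suml.
rewrite exchange_big mulr_sumr; apply: eq_bigr => e _ /=.
rewrite (bigD1 (flip S e)) //= big1 ?addr0 => [|H HS].
  rewrite eqxx (negPf _ : (S == flip S e) = false) 1?eq_sym ?flip_neq //.
  rewrite mulr1 mulr0 addr0 [pi S * _]mulrCA gibbs_accept_min /flip_energy invfM; ring.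
rewrite [flip S e == H]eq_sym (negPf HS) mulr0 add0r.
case: eqP => [->|_]; last by rewrite !mulr0 mul0r.
by rewrite subrr expr0n mulr0.
Qed.

Lemma bond_flip_lazy S : edges G != set0 -> 2^-1 <= P S S.
Proof.
move=> E0; have m_gt0 := edge_gt0 E0.
have -> : 2^-1 = \sum_(e : edge G) m%:R^-1 * 2^-1 :> R.
  rewrite -mulr_suml sumr_const -[_ *+ #|_|]mulr_natl divff ?mul1r //.
  by rewrite pnatr_eq0 -lt0n.
apply: ler_sum => e _; apply: ler_wpM2l; first by rewrite invr_ge0.
rewrite (negPf (flip_neq S e)) eqxx mulr0 add0r mulr1 /accept.
set t := w _ / w _; have : Num.min 1 t <= 1 by rewrite ge_min lexx.
lra.
Qed.

Section Order.
Variables (s : seq (edge G)) (c : R).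
Hypothesis s_uniq : uniq s.
Hypothesis s_all : forall e, e \in s.
Hypothesis c_ge0 : 0 <= c.
Hypothesis pi_mix : forall i I F, let A := [set e in take i s] in
  pi I * pi F <= c * (pi (mix A I F) * pi (mix A F I)).

Let size_s : size s = m.
Proof. by rewrite -(card_uniqP s_uniq); apply/esym/eq_card => e; rewrite s_all. Qed.

(** The hypothesis before or after treating [e] is used according to which of [S] and [flip S e] has
    the smaller mass, the one in [flip_energy]. The sum over (I, F) becomes a sum over (S, U), where
    the masses of [U] and [flip U e] add up to 2. *)
Lemma step_congestion f A e : e \notin A ->
  (forall I F, pi I * pi F <= c * (pi (mix A I F) * pi (mix A F I))) ->
  (forall I F, pi I * pi F
     <= c * (pi (mix (e |: A) I F) * pi (mix (e |: A) F I))) ->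
  \sum_I \sum_F pi I * pi F * (f (mix A I F) - f (mix (e |: A) I F)) ^+ 2
  <= 2 * c * \sum_S flip_energy f e S.
Proof.
move=> eA le_A le_eA.
pose h p := c * flip_energy f e p.1 * (pi p.2 + pi (flip p.2 e)).
have term_le I F : pi I * pi F * (f (mix A I F) - f (mix (e |: A) I F)) ^+ 2
    <= h (mix A I F, mix A F I).
  have := le_eA I F; rewrite !mix_setU1 //.
  rewrite [(e \in F) (+) _]addbC; case: ifP => _ le2; last first.
    rewrite subrr expr0n mulr0 /h; apply: mulr_ge0.
      by apply: mulr_ge0 => //; apply: flip_energy_ge0.
    by apply: addr_ge0; apply: ltW.
  have le1 := le_A I F; rewrite /h /flip_energy /=; move: le1 le2.
  set S := mix A I F; set U := mix A F I => le1 le2.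
  rewrite [c * (_ * _)]mulrA [leRHS]mulrAC -[c * _ * _]mulrA.
  apply: ler_wpM2r; first exact: sqr_ge0.
  case: (leP (pi S)) => _.
    apply: le_trans le1 _; apply: ler_wpM2l => //; rewrite ler_pM2l //.
    by rewrite lerDl ltW.
  apply: le_trans le2 _; apply: ler_wpM2l => //; rewrite ler_pM2l //.
  by rewrite lerDr ltW.
apply: (@le_trans _ _ (\sum_I \sum_F h (mix A I F, mix A F I))).
  by apply: ler_sum => I _; apply: ler_sum => F _.
rewrite pair_big /= -(reindex_inj (P := xpredT) (F := h) (inv_inj (@mixK G A))).
rewrite -(pair_bigA _ (fun S U => h (S, U))) /= mulr_sumr.
apply: ler_sum => S _; rewrite /h /= -mulr_sumr big_split /=.
have pi1 : \sum_U pi U = 1 by have [] := gibbs_distr G w_pos.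
rewrite pi1 -(reindex_inj (P := xpredT) (F := pi) (inv_inj (@flipK G e))) pi1.
by rewrite le_eqVlt; apply/orP; left; apply/eqP; ring.
Qed.

(** Telescoping along the path and Cauchy-Schwarz give a factor m, each step contributes 2c, and the
    Dirichlet form carries the normalisation 1/(2m). *)
Lemma bond_flip_poincare f : edges G != set0 ->
  pair_variance pi f <= 4 * m%:R ^+ 2 * c * dirichlet P pi f.
Proof.
move=> E0; have m_gt0 := edge_gt0 E0.
have [e0 _] : exists e0 : edge G, e0 \in edge G by apply/card_gt0P.
have m_neq0 : m%:R != 0 :> R by rewrite pnatr_eq0 -lt0n.
pose A i := [set e in take i s]; pose d i I F := f (mix (A i) I F) - f (mix (A i.+1) I F).
have AS i : (i < m)%N -> (nth e0 s i \notin A i) /\ A i.+1 = nth e0 s i |: A i.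
  move=> im; have iS : take i.+1 s = rcons (take i s) (nth e0 s i).
    by rewrite (take_nth e0) // size_s.
  have := take_uniq i.+1 s_uniq; rewrite iS rcons_uniq => /andP[iN _].
  split; first by rewrite inE.
  by apply/setP => e; rewrite /A iS !inE mem_rcons inE.
have tele I F : f I - f F = \sum_(i < m) d i I F.
  have -> : \sum_(i < m) d i I F
      = - \sum_(0 <= i < m) (f (mix (A i.+1) I F) - f (mix (A i) I F)).
    by rewrite big_mkord -sumrN; apply: eq_bigr => i _; rewrite opprB.
  rewrite telescope_sumr // opprB; congr (f _ - f _).
    rewrite /A take0 (_ : [set _ in _] = set0) ?mix_set0 //.
  rewrite /A -size_s take_size (_ : [set _ in _] = setT) ?mix_setT //.
  by apply/setP => e; rewrite !inE s_all.
have cs I F : (f I - f F) ^+ 2 <= m%:R * \sum_(i < m) d i I F ^+ 2.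
  have p_sum : \sum_(i < m) m%:R^-1 = 1 :> R.
    by rewrite sumr_const card_ord -[_ *+ m]mulr_natl divff.
  have := sqr_sum_le (p := fun i : 'I_m => m%:R^-1) (fun i => d i I F) _ p_sum.
  rewrite -!mulr_sumr -tele => /(_ _) le_d.
  have : (m%:R^-1 * (f I - f F)) ^+ 2 <= m%:R^-1 * \sum_(i < m) d i I F ^+ 2.
    by apply: le_d => i; rewrite invr_ge0.
  rewrite -(ler_pM2l (_ : 0 < m%:R ^+ 2 :> R)) ?exprn_gt0 ?ltr0n //.
  rewrite [leLHS](_ : _ = (f I - f F) ^+ 2); last by field.
  by rewrite [leRHS](_ : _ = m%:R * \sum_(i < m) d i I F ^+ 2); last by field.
have -> : 4 * m%:R ^+ 2 * c * dirichlet P pi f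
    = m%:R * \sum_(i < m) (2 * c * \sum_S flip_energy f (nth e0 s i) S).
  rewrite dirichlet_bond_flip -mulr_sumr.
  have -> : \sum_(i < m) \sum_S flip_energy f (nth e0 s i) S
      = \sum_e \sum_S flip_energy f e S.
    rewrite -(big_mkord xpredT (fun i => \sum_S flip_energy f (nth e0 s i) S)) -size_s.
    rewrite -(big_nth e0 xpredT (fun e => \sum_S flip_energy f e S)).
    apply: perm_big; apply: uniq_perm => //; first exact: index_enum_uniq.
    by move=> e; rewrite s_all mem_index_enum.
  by field.
apply: (@le_trans _ _ (\sum_I \sum_F \sum_(i < m)
   m%:R * (pi I * pi F * d i I F ^+ 2))).
  apply: ler_sum => I _; apply: ler_sum => F _.
  rewrite -!mulr_sumr [leRHS]mulrCA; apply: ler_wpM2l; last exact: cs.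
  by apply: mulr_ge0; apply: ltW.
under eq_bigr => I _ do rewrite exchange_big /=.
rewrite exchange_big mulr_sumr; apply: ler_sum => i _ /=.
under eq_bigr => I _ do rewrite -mulr_sumr.
rewrite -mulr_sumr; apply: ler_wpM2l => //.
have [iN iE] := AS i (ltn_ord i).
rewrite /d iE; apply: step_congestion => // [I F|I F]; first exact: pi_mix.
by rewrite -iE; apply: pi_mix.
Qed.

End Order.

Section FlipRatio.
Variable D : R.
Hypothesis D_ge1 : 1 <= D.
Hypothesis w_flip_le : forall S e, w (spanning (flip S e)) <= D * w (spanning S).

(** The canonical path from [I] to [F] has m steps, each costing at most a factor [D]. *)
Lemma w_spanning_ratio I F : w (spanning I) <= D ^+ m * w (spanning F).
Proof.
have D_gt0 : 0 < D by apply: lt_le_trans D_ge1.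
have mix_le s : uniq s ->
    w (spanning I) <= D ^+ size s * w (spanning (mix [set e in s] I F)).
  elim: s => [_|e s IH /=/andP[es us]].
    by rewrite expr0 mul1r (_ : [set _ in _] = set0) ?mix_set0 //.
  apply: le_trans (IH us) _; rewrite exprSr -mulrA ler_pM2l ?exprn_gt0 //.
  have -> : [set e' in e :: s] = e |: [set e' in s] by apply/setP => x; rewrite !inE.
  rewrite mix_setU1 ?inE //; case: ifP => _.
    by rewrite -{1}[mix _ _ _](flipK e); apply: w_flip_le.
  by rewrite -[leLHS]mul1r ler_pM2r.
have := mix_le _ (enum_uniq (edge G)).
rewrite -cardE (_ : [set _ in _] = setT) ?mix_setT //.
by apply/setP => e; rewrite !inE mem_enum.
Qed.

(** The normalising sum has 2^m terms, each at most D^m w(S). *)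
Lemma gibbs_ge S : expR (- (m%:R * ln (2 * D))) <= pi S.
Proof.
have D_gt0 : 0 < D by apply: lt_le_trans D_ge1.
have D2_gt0 : 0 < 2 * D by rewrite mulr_gt0.
rewrite expRN expRM_natl lnK ?posrE // /gibbs ler_pdivlMr ?Z_gt0 //.
rewrite mulrC ler_pdivrMr ?exprn_gt0 //.
apply: (@le_trans _ _ (\sum_(H : {set edge G}) D ^+ m * w (spanning S))).
  by apply: ler_sum => H _; apply: w_spanning_ratio.
rewrite sumr_const -[_ *+ #|_|]mulr_natl.
have -> : #|{set edge G}| = (2 ^ m)%N by rewrite -!cardsT -powersetT card_powerset.
by rewrite natrX exprMn [leRHS]mulrC mulrA.
Qed.

End FlipRatio.
End Congestion.

(** * From the congestion bound to a power of n *)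

Lemma gibbs_mix (R : realType) (w : sgraph -> R) (lambda : R) (G : sgraph)
    (A I F : {set edge G}) b :
  graph_function w -> (forall G : sgraph, 0 < w G) -> 0 < lambda ->
  lambda_multiplicative lambda w -> (#|front A| <= b)%N ->
  gibbs w I * gibbs w F
  <= lhat lambda ^+ (4 * b) * (gibbs w (mix A I F) * gibbs w (mix A F I)).
Proof.
move=> wG w_gt0 l_gt0 wM Ab; rewrite /gibbs; set Z := \sum_(H : _) _.
have Z_gt0 : 0 < Z := Z_gt0 G w_gt0.
have := w_mix wG w_gt0 l_gt0 wM I F Ab.
rewrite -(ler_pM2r (_ : 0 < Z^-1 ^+ 2)) ?exprn_gt0 ?invr_gt0 //.
set c := lhat _ ^+ _; set a1 := w _; set a2 := w _; set a3 := w _; set a4 := w _.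
rewrite [a1 * a2 * _](_ : _ = a1 / Z * (a2 / Z)); last by ring.
by rewrite [leRHS](_ : _ = c * (a3 / Z * (a4 / Z))); last by ring.
Qed.

Lemma ln_lhat (R : realType) (lambda : R) : 0 < lambda ->
  ln (lhat lambda) = `|ln lambda|.
Proof.
move=> l_gt0; rewrite /lhat; have lnl := @lnV R lambda l_gt0.
have l'_gt0 : 0 < lambda^-1 by rewrite invr_gt0.
have [l1|l1] := leP 1 lambda.
  rewrite ger0_norm ?ln_ge0 //; congr ln; apply/max_idPl.
  by apply: (le_trans _ l1); rewrite invr_le1 ?unitfE ?gt_eqF.
rewrite ler0_norm ?ln_le0 ?ltW // -lnl; congr ln; apply/max_idPr.
by apply: (le_trans (ltW l1)); rewrite invr_ge1 ?unitfE ?gt_eqF ?ltW.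
Qed.

(** This is log^3 n = O(n) when 2^i <= n. Equality at i = 3 forces the constant 8; from i = 4 on,
    the cube grows by a factor less than 2 per step. *)
Lemma cube_le_exp2 i : (i.+1 ^ 3 <= 8 * 2 ^ i)%N.
Proof.
case: (ltnP i 4) => [|i4]; first by case: i => [|[|[|[|]]]].
rewrite -(subnK i4); elim: (i - 4)%N => //= j IH.
rewrite addSn expnS; move: IH; set p := (2 ^ _)%N; rewrite !expnS !expn0; nia.
Qed.

Lemma cube_le m k n i : (m <= k * i.+1 * n)%N -> (2 ^ i <= n)%N ->
  (m ^ 3 <= 8 * k ^ 3 * n ^ 4)%N.
Proof.
move=> m_le i_le; apply: (@leq_trans ((k * i.+1 * n) ^ 3)); first by rewrite leq_exp2r.
have -> : (8 * k ^ 3 * n ^ 4 = k ^ 3 * (8 * n) * n ^ 3)%N.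
  by rewrite [(n ^ 4)%N]expnS; ring.
rewrite !expnMn leq_mul2r; apply/orP; right; rewrite leq_mul2l; apply/orP; right.
by apply: leq_trans (cube_le_exp2 i) _; rewrite leq_mul2l.
Qed.

Lemma ler_pM_cube (R : realFieldType) (m k n x y z : R) :
  0 <= m -> 0 <= y -> m ^+ 3 <= 8 * k ^+ 3 * n ^+ 4 -> y <= z * x ->
  4 * m ^+ 2 * y * m <= 32 * k ^+ 3 * z * (n ^+ 4 * x).
Proof.
move=> m_ge0 y_ge0 m3_le y_le.
have -> : 4 * m ^+ 2 * y * m = 4 * (m ^+ 3 * y) by ring.
have -> : 32 * k ^+ 3 * z * (n ^+ 4 * x) = 4 * (8 * k ^+ 3 * n ^+ 4 * (z * x)) by ring.
by rewrite ler_pM2l // ler_pM ?exprn_ge0.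
Qed.

Theorem theorem1 (R : realType) (w : sgraph -> R) (lambda : R)
  (w_graph : graph_function w)
  (w_pos : forall G : sgraph, 0 < w G)
  (lambda_pos : 0 < lambda)
  (w_mult : lambda_multiplicative lambda w) :
  exists C : nat -> R,
    forall (G : sgraph) (eps : R),
      edges G != finset.set0 -> 0 < eps -> eps <= 2^-1 ->
      (mixing_time (@bond_flip R w G) (@gibbs R w G) eps <=
       (C (treewidth G)
        * #|G|%:R `^ (4 + 4 * (treewidth G + 1)%:R * `|ln lambda / ln 2|)
        * ln (1 / eps))%:E)%E.
Proof.
set L := lhat lambda.
have L_ge1 : 1 <= L := lhat_ge1 lambda_pos.
have L_gt0 : 0 < L := lt_le_trans ltr01 L_ge1.
pose D := edge_ratio w lambda.
have D_ge1 : 1 <= D := edge_ratio_ge1 w_pos lambda_pos.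
have ln2_gt0 : 0 < ln 2 :> R by rewrite ln_gt0 // ltr1n.
have lnD_ge0 : 0 <= ln (2 * D) by rewrite ln_ge0 //; lra.
(* With l = ln(1/eps) >= ln 2, the three terms of rho (m ln(2D) + 2l) + 1 are at most rho m l times
   ln(2D)/ln 2, 2 and 1/ln 2, which add up to [c]. *)
pose c := (ln (2 * D) + 1) / ln 2 + 2.
have c_gt0 : 0 < c.
  by rewrite /c ltr_wpDl // divr_ge0 ?ltW //; lra.
(* 32 is the 4 of the Poincare constant times the 8 of [cube_le_exp2]; the power of [L] comes from
   the one level of recursion beyond log_2 n. *)
exists (fun k => 32 * (k + 1)%:R ^+ 3 * L ^+ (4 * (k + 1)) * c).
move=> G eps E0 eps_gt0 eps_le.
have eps_le1 : eps <= 1 by lra.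
set l := ln (1 / eps).
have l_ge : ln 2 <= l.
  have eps_inv : 2 <= 1 / eps by rewrite ler_pdivlMr //; lra.
  by rewrite ler_ln // posrE; lra.
set k := (treewidth G + 1)%N; set n := #|G|.
have n_gt0 : (0 < n)%N.
  have /card_gt0P[e _] := edge_gt0 E0.
  have /card_gt0P[x _] : (0 < #|val e|)%N by rewrite card_edge.
  by apply/card_gt0P; exists x.
(* n < 2^(i+1) allows a recursion of i + 1 levels, and 2^i <= n converts the result back into powers
   of n. *)
pose i := trunc_log 2 n; have /andP[i_le i_gt] := trunc_log_bounds (ltnSn 1) n_gt0.
rewrite -/i in i_le i_gt.
have [m_le [s [s_uniq s_all s_front]]] := edge_order i_gt.
set b := (_ * i.+1)%N in m_le s_front; set m := #|edge G| in m_le.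
have m_gt0 : (0 < m)%N := edge_gt0 E0.
have m_ge1 : 1 <= m%:R :> R by rewrite ler1n.
have Lb_ge1 : 1 <= L ^+ (4 * b) by rewrite exprn_ege1.
pose rho := 4 * m%:R ^+ 2 * L ^+ (4 * b).
have m2_ge1 : 1 <= m%:R ^+ 2 :> R by rewrite exprn_ege1.
have rho_ge1 : 1 <= rho by rewrite /rho !mulr_ege1 ?ler1n.
have mix_le := mixing_time_poincare (gibbs_gt0 w_pos) (proj2 (gibbs_distr G w_pos))
  (bond_flip_ge0 w_pos (G := G)) (bond_flip_sum w E0) (gibbs_reversible w_pos (G := G))
  (fun S => bond_flip_lazy w S E0) rho_ge1
  (fun f => bond_flip_poincare w_pos s_uniq s_all (ltW (lt_le_trans ltr01 Lb_ge1))
     (fun i I F => gibbs_mix I F w_graph w_pos lambda_pos w_mult (s_front i)) f E0)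
  (mulr_ge0 (ltW (lt_le_trans ltr01 m_ge1)) lnD_ge0)
  (gibbs_ge w_pos D_ge1 (fun S e => w_flip w_graph w_pos lambda_pos w_mult S e))
  eps_gt0.
apply: le_trans (mix_le eps_le1) _.
rewrite lee_fin -/l.
apply: (@le_trans _ _ (rho * m%:R * c * l)).
  have lq : 1 <= l / ln 2 by rewrite ler_pdivlMr // mul1r.
  have rm : 1 <= rho * m%:R by rewrite mulr_ege1.
  have -> : rho * m%:R * c * l
      = rho * (m%:R * (ln (2 * D) * (l / ln 2)) + m%:R * (2 * l))
        + rho * m%:R * (l / ln 2).
    by rewrite /c; field; rewrite gt_eqF.
  apply: lerD; last by rewrite mulr_ege1.
  rewrite ler_pM2l ?(lt_le_trans _ rho_ge1) //; apply: lerD.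
    by rewrite ler_pM2l ?(lt_le_trans _ m_ge1) // ler_peMr.
  rewrite ler_peMl // mulr_ge0 //; apply: le_trans l_ge; exact: ltW.
apply: ler_wpM2r; first by apply: le_trans l_ge; apply: ltW.
rewrite [leRHS]mulrAC ler_pM2r //.
have m3_le : m%:R ^+ 3 <= 8 * k%:R ^+ 3 * n%:R ^+ 4 :> R.
  rewrite -!natrX -!natrM ler_nat.
  exact: cube_le m_le i_le.
have nR_gt0 : 0 < n%:R :> R by rewrite ltr0n.
have -> : `|ln lambda / ln 2| = ln L / ln 2.
  by rewrite normrM /L ln_lhat // (gtr0_norm (_ : 0 < (ln 2)^-1)) ?invr_gt0.
rewrite powRD; last by rewrite (gt_eqF nR_gt0) implybT.
rewrite powR_mulrn ?(ltW nR_gt0) //.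
set x := n%:R `^ _.
(* Here b = k (i + 1), and L^(4ki) = (2^i)^(4k log_2 L) <= n^(4k log_2 L). *)
have Lb_le : L ^+ (4 * b) <= L ^+ (4 * k) * x.
  have -> : (4 * b = 4 * k + 4 * k * i)%N by rewrite /b -/k mulnS mulnDr mulnA.
  rewrite exprD ler_pM2l ?exprn_gt0 //.
  rewrite /x /powR (gt_eqF nR_gt0) -[L in leLHS]lnK ?posrE // -expRM_natl ler_expR.
  have lnL : 0 <= ln L by rewrite ln_ge0.
  have i_ln : i%:R <= ln n%:R / ln 2 :> R.
    rewrite ler_pdivlMr // mulr_natl -lnXn //.
    rewrite ler_ln ?posrE ?exprn_gt0 //.
    by rewrite -natrX ler_nat.
  rewrite natrM natrM.
  have -> : 4 * k%:R * (ln L / ln 2) * ln n%:R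
      = 4 * k%:R * ln L * (ln n%:R / ln 2) by ring.
  rewrite [leLHS](_ : _ = 4 * k%:R * ln L * i%:R); last by ring.
  apply: ler_wpM2l i_ln.
  by rewrite !mulr_ge0.
rewrite /rho; apply: ler_pM_cube m3_le Lb_le; first by rewrite ler0n.
by apply: ltW; apply: lt_le_trans Lb_ge1.
Qed.
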